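(* Let $n\geq 2$ be an integer. The shortest $2$-reachability network on $n$ elements contains exactly $\lceil 3n/2\rceil-2$ transpositions; that is, there exists a $2$-reachability network on $n$ elements of length $\lceil 3n/2\rceil-2$, and every $2$-reachability network on $n$ elements has length at least $\lceil 3n/2\rceil-2$.
   Context: Write $[n]=\{1,\dots,n\}$, let $S_n$ be the symmetric group on $[n]$, and for distinct $a,b\in[n]$ let $(a,b)\in S_n$ denote the transposition swapping $a$ and $b$. For $1\le t\le n$, a finite sequence of transpositions $T_1,\dots,T_\ell\in S_n$ (repetitions allowed), with $T_i=(a_i,b_i)$, is a $t$-reachability network on $n$ elements if for every choice of $t$ distinct ordered points $x_1,\dots,x_t\in[n]$ there is a (possibly empty) subsequence $T_{i_1},\dots,T_{i_{\ell'}}$ with $i_1<\dots<i_{\ell'}$ whose composition $(a_{i_1},b_{i_1})\cdots(a_{i_{\ell'}},b_{i_{\ell'}})$ maps $j\mapsto x_j$ for every $1\le j\le t$. Products are applied in the order of the sequence, left to right: $T_{i_1}$ is applied first (equivalently, counters placed at positions $1,\dots,t$ are moved by carrying out the chosen switches in order, and counter $j$ must end at position $x_j$). The length of the network is $\ell$, the number of transpositions in the sequence. *)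

(* Defs.v *)
From mathcomp Require Import all_boot all_order all_fingroup.

Set Implicit Arguments.
Unset Strict Implicit.
Unset Printing Implicit Defensive.

Definition is_transposition (n : nat) (s : 'S_n) : bool :=
  [exists a : 'I_n, exists b : 'I_n, (a != b) && (s == tperm a b)].

(* The points 1, ..., n are represented by 0, ..., n - 1 in 'I_n, so the
   starting positions 1, ..., t are the images of 'I_t under widen_ord.
   Permutations compose left to right, (s * u) i = u (s i) (permM), so the
   leftmost factor of the ordered product is applied first. *)
Definition reachability_network (n t : nat) (le_t_n : t <= n)
    (T : seq 'S_n) : Prop :=
  all (@is_transposition n) T /\
  forall x : 'I_t -> 'I_n, injective x ->
    exists2 U : seq 'S_n, subseq U T &
      forall j : 'I_t, (\prod_(u <- U) u)%g (widen_ord le_t_n j) = x j.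

(* Main.v *)
Require Import Defs.
From mathcomp Require Import all_boot all_order all_fingroup.
From mathcomp Require Import zify.

(** Lower bound: colour the positions by 0 if no counter can have arrived, by 1
    (resp. 2) if only the first (resp. second) counter can be there, and by
    colours >= 3 otherwise, so that two positions of equal colour are never
    occupied simultaneously.  A switch between a reached and an unreached
    position copies the colour of the former; a switch between two reached
    positions costs two fresh colours.  Hence 2 #reached + #colours grows by at
    most 2 per switch, from 4 to at least 3n.

    Upper bound: three switches suffice to add two positions a and b to a
    network containing u and v, namely (b,v), (a,u), (a,b) in this order. *)

Set Implicit Arguments.
Unset Strict Implicit.
Unset Printing Implicit Defensive.

Section Pairs.

Variable n : nat.
Implicit Types (p q x y u v a b : 'I_n) (s : 'S_n) (T U E : seq 'S_n).

(** * Moving an ordered pair of counters *)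

Definition pair_reachable p q T x y :=
  exists2 U, subseq U T & (\prod_(g <- U) g)%g p = x /\ (\prod_(g <- U) g)%g q = y.

Lemma reachability_network2P (hn : 2 <= n) T :
  reachability_network hn T <->
  all (@is_transposition n) T /\
  forall x y, x != y ->
    pair_reachable (widen_ord hn ord0) (widen_ord hn ord_max) T x y.
Proof.
split=> -[trT reachT]; split=> //; [move=> x y xy | move=> x x_inj].
  have inj_xy : injective (fun j : 'I_2 => if j == ord0 then x else y).
    by move=> [[|[|i]] //= ?] [[|[|j]] //= ?] /= exy; apply: val_inj => //=;
      move: xy; rewrite exy eqxx.
  have [U sUT UE] := reachT _ inj_xy.
  by exists U => //; rewrite !UE.
have xy : x ord0 != x ord_max by apply/eqP => /x_inj.
have [U sUT [U0 U1]] := reachT _ _ xy.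
exists U => // -[[|[|j]] // lt_j2].
  by rewrite (_ : Ordinal _ = ord0) //; apply: val_inj.
by rewrite (_ : Ordinal _ = ord_max) //; apply: val_inj.
Qed.

Lemma subseq_rcons U T s :
  subseq U (rcons T s) ->
  subseq U T \/ exists2 V, subseq V T & U = rcons V s.
Proof.
rewrite -cats1 => /subseqP[m sz_m ->].
have lt_m : size T <= size m by rewrite sz_m size_cat leq_addr.
rewrite -(cat_take_drop (size T) m) mask_cat ?size_takel //.
have: size (drop (size T) m) = 1 by rewrite size_drop sz_m size_cat addKn.
case: (drop _ _) => [|[] []] //= _; rewrite ?cats0 ?cats1.
  by right; exists (mask (take (size T) m) T); rewrite ?mask_subseq.
by left; rewrite mask_subseq.
Qed.

(** The last switch is either skipped or performed; this drives the induction on the end of the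
    sequence. *)
Lemma pair_reachable_rcons p q T s x y :
  pair_reachable p q (rcons T s) x y ->
  exists x' y', pair_reachable p q T x' y' /\
    ((x, y) = (x', y') \/ (x, y) = (s x', s y')).
Proof.
case=> U /subseq_rcons[sUT | [V sVT ->]] [<- <-].
  by exists ((\prod_(g <- U) g)%g p), ((\prod_(g <- U) g)%g q); split; [exists U | left].
exists ((\prod_(g <- V) g)%g p), ((\prod_(g <- V) g)%g q); split; first by exists V.
by right; rewrite -cats1 big_cat big_seq1 !permM.
Qed.

(** * Lower bound by colouring *)

Definition proper_coloring p q T (c : 'I_n -> nat) :=
  forall x y, pair_reachable p q T x y ->
    [/\ c x != 0, c y != 0, c x != 2, c y != 1 & c x != c y].

Definition nb_reached (c : 'I_n -> nat) := #|[set x | c x != 0]|.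

(** The first counter sits at [x] and the second at [y] in [proper_coloring], hence the asymmetric
    bans on colours 2 and 1. A colouring may allow pairs that are not reachable, which keeps each
    update local to the switched positions. [k] counts the fresh colours issued, even if some were
    overwritten later. *)
Lemma exists_proper_coloring p q T :
  p != q -> all (@is_transposition n) T ->
  exists c k, [/\ proper_coloring p q T c, forall x, c x < k + 3
                & 2 * nb_reached c + k <= 2 * size T + 4].
Proof.
move=> pq; elim/last_ind: T => [_|T s IH].
  exists (fun x => if x == p then 1 else if x == q then 2 else 0), 0; split.
  - move=> x y [U]; rewrite subseq0 => /eqP-> [].
    by rewrite big_nil !perm1 => <- <-; rewrite eq_sym in pq; rewrite !eqxx (negPf pq).
  - by move=> x; case: ifP => // _; case: ifP.
  - rewrite /nb_reached (_ : [set x | _] = [set p; q]) ?cards2 ?pq //.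
    by apply/setP => x; rewrite !inE; case: (x == p) => //; case: (x == q).
rewrite all_rcons size_rcons => /andP[trs /IH[c [k [cP ck cardc]]]].
case/existsP: trs => u /existsP[v /andP[uv /eqP->]].
(* Before the switch no counter is at [z], so afterwards at most one of [w], [z] is occupied and
   they may share a colour. One more reached position costs 2. *)
have grow w z : c w != 0 -> c z == 0 -> z != w ->
    exists c' k', [/\ proper_coloring p q (rcons T (tperm w z)) c',
      forall x, c' x < k' + 3
      & 2 * nb_reached c' + k' <= 2 * (size T).+1 + 4].
  move=> cw /eqP cz zw; pose c' x := if x == z then c w else c x.
  have c'E x : c x != 0 -> c' x = c x /\ c' (tperm w z x) = c x.
    rewrite /c' => cx; have xz : x != z by apply: contraNneq cx => ->; rewrite cz.
    rewrite (negPf xz); split=> //.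
    by case: tpermP => [->|/eqP|/eqP ? ?]; rewrite ?eqxx ?(negPf xz).
  exists c', k; split=> [x y|x|]; last 1 first.
  - suff -> : nb_reached c' = (nb_reached c).+1 by lia.
    rewrite /nb_reached (_ : [set x | c' x != 0] = z |: [set x | c x != 0]).
      by rewrite cardsU1 inE cz eqxx.
    by apply/setP => x; rewrite !inE /c'; case: (x == z); rewrite ?cw.
  - case/pair_reachable_rcons => x' [y' [/cP[cx cy ? ? ?]]].
    have [ex etx] := c'E _ cx; have [ey ety] := c'E _ cy.
    by case=> -[-> ->]; rewrite ?ex ?ey ?etx ?ety.
  - by rewrite /c'; case: ifP.
have [cu|cu] := eqVneq (c u) 0; have [cv|cv] := eqVneq (c v) 0.
(* Neither position can hold a counter, so the switch moves nothing. *)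
- exists c, k; split=> //; last lia.
  move=> x y /pair_reachable_rcons[x' [y' [/cP xyP]]].
  have fixE z : c z != 0 -> tperm u v z = z.
    by move=> cz; rewrite tpermD //; apply: contraNneq cz => <-; rewrite ?cu ?cv.
  by case: (xyP) => cx cy _ _ _ [] [-> ->] //; rewrite !fixE.
- by rewrite tpermC; apply: grow; rewrite ?cu.
- by apply: grow; rewrite ?cv // eq_sym.
(* Both colours exceed every old one and are at least 3, so they clash with nothing. The reached set
   is unchanged and [k] absorbs the cost 2. *)
pose c' x := if x == u then k + 3 else if x == v then k + 4 else c x.
exists c', (k + 2); split=> [x y|x|]; last 1 first.
- suff -> : nb_reached c' = nb_reached c by lia.
  rewrite /nb_reached; congr #|pred_of_set _|; apply/setP => x; rewrite !inE /c'.
  by case: (eqVneq x u) => [->|_]; last case: (eqVneq x v) => [->|_]; rewrite ?cu ?cv ?addnS.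
- case/pair_reachable_rcons => x' [y' [/cP[cx cy cx2 cy1 cxy]]].
  have xy' : x' != y' by apply: contraNneq cxy => ->.
  have xy : (x, y) = (x', y') \/ (x, y) = (tperm u v x', tperm u v y') -> x != y.
    by case=> -[-> ->] //; rewrite (inj_eq perm_inj).
  have newP z z' : z' = z \/ z' = tperm u v z ->
      [\/ z' = u /\ c' z' = k + 3, z' = v /\ c' z' = k + 4 | c' z' = c z].
    rewrite /c'; have [->|z'u] := eqVneq z' u; first by constructor 1.
    have [->|z'v] := eqVneq z' v; first by constructor 2.
    case=> z'E; constructor 3; rewrite z'E //.
    by move: z'u z'v; rewrite z'E; case: tpermP => //; rewrite eqxx.
  move=> xyE; have xneqy := xy xyE.
  have /newP xP : x = x' \/ x = tperm u v x' by case: xyE => -[]; auto.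
  have /newP yP : y = y' \/ y = tperm u v y' by case: xyE => -[]; auto.
  have := ck x'; have := ck y'.
  case: xP => [[xE ->]|[xE ->]|->]; case: yP => [[yE ->]|[yE ->]|->];
    by move: xneqy; rewrite ?xE ?yE ?eqxx //; split; lia.
- by rewrite /c'; have := ck x; case: ifP => _; last case: ifP => _; lia.
Qed.

Lemma size_pair_network p q T :
  p != q -> all (@is_transposition n) T ->
  (forall x y, x != y -> pair_reachable p q T x y) ->
  3 * n <= 2 * size T + 4.
Proof.
move=> pq trT reachT.
have [c [k [cP ck cardc]]] := exists_proper_coloring pq trT.
have other x : exists y, x != y.
  by have [->|xp] := eqVneq x p; [exists q | exists p].
(* Each position must be able to receive either counter, which excludes colours 0, 1 and 2. *)
have c_ge3 x : 3 <= c x.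
  have [y xy] := other x; have [cx _ cx2 _ _] := cP _ _ (reachT _ _ xy).
  rewrite eq_sym in xy; have [_ _ _ cx1 _] := cP _ _ (reachT _ _ xy).
  by case: (c x) cx cx1 cx2 => [|[|[]]].
have c_inj : injective c.
  move=> x y cxy; apply/eqP; apply/negPn/negP => /reachT/cP[_ _ _ _].
  by rewrite cxy eqxx.
have reached_n : nb_reached c = n.
  rewrite /nb_reached (_ : [set x | _] = setT) ?cardsT ?card_ord //.
  by apply/setP => x; rewrite !inE -lt0n (leq_trans _ (c_ge3 x)).
(* The [n] distinct colours lie among the [k] values from 3 to [k + 2]. *)
have le_nk : n <= k.
  have : uniq (map c (enum 'I_n)) by rewrite map_inj_uniq ?enum_uniq.
  move/uniq_leq_size => /(_ (iota 3 k)); rewrite size_map size_enum_ord size_iota.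
  apply=> _ /mapP[x _ ->]; rewrite mem_iota c_ge3 /=; have := ck x; lia.
by lia.
Qed.

(** * Upper bound by adding positions *)

Definition pair_network p q m T :=
  all (@is_transposition n) T /\
  forall x y, x < y -> y < m -> pair_reachable p q T x y /\ pair_reachable p q T y x.

Lemma is_transposition_tperm u v : u != v -> is_transposition (tperm u v).
Proof. by move=> uv; apply/existsP; exists u; apply/existsP; exists v; rewrite uv eqxx. Qed.

(** [T] supplies both orders of any pair below [m], so each unordered target pair need only be
    traced back through [E] once, in whichever order its sources come. *)
Lemma pair_network_cat p q m m' T E :
  pair_network p q m T -> all (@is_transposition n) E ->
  (forall x y, x < y -> y < m' ->
    exists x' y', [/\ x' < m, y' < m & pair_reachable x' y' E x y]) ->
  pair_network p q m' (T ++ E).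
Proof.
move=> [trT reachT] trE reachE; split=> [|x y lt_xy lt_y].
  by rewrite all_cat trT.
have [x' [y' [lt_x' lt_y' [V sVE [VxE VyE]]]]] := reachE x y lt_xy lt_y.
have [U sUT [UxE UyE]] : pair_reachable p q T x' y'.
  have [/reachT[] //|/reachT[] //|/val_inj x'y'] := ltngtP x' y'.
  by move: lt_xy; rewrite -VxE -VyE x'y' ltnn.
have [U' sUT' [UyE' UxE']] : pair_reachable p q T y' x'.
  have [/reachT[] //|/reachT[] //|/val_inj x'y'] := ltngtP x' y'.
  by move: lt_xy; rewrite -VxE -VyE x'y' ltnn.
split; [exists (U ++ V) | exists (U' ++ V)]; rewrite ?cat_subseq //.
  by rewrite big_cat !permM UxE UyE VxE VyE.
by rewrite big_cat !permM UxE' UyE' VxE VyE.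
Qed.

Lemma pair_network_tperm p q :
  p = 0 :> nat -> q = 1 :> nat -> pair_network p q 2 [:: tperm p q].
Proof.
move=> p0 q1; split=> [|x y lt_xy lt_y].
  by rewrite /= is_transposition_tperm // -val_eqE /= p0 q1.
have -> : x = p by apply: val_inj => /=; lia.
have -> : y = q by apply: val_inj => /=; lia.
split; first by exists [::]; rewrite ?sub0seq // big_nil !perm1.
by exists [:: tperm p q]; rewrite ?subseq_refl // big_seq1 tpermL tpermR.
Qed.

(** Position [a] is fed from [u]. If [u] is also a target, the switch of [u] and [v] refills it from
    [v]. *)
Lemma pair_network_add1 p q u v a m T :
  u < m -> v < m -> u != v -> a = m :> nat -> pair_network p q m T ->
  pair_network p q m.+1 (T ++ [:: tperm a u; tperm u v]).
Proof.
move=> lt_u lt_v uv am netT.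
have lt_neq x : x < m -> a != x by rewrite -val_eqE /= am; lia.
have [au av] := (lt_neq u lt_u, lt_neq v lt_v).
apply: pair_network_cat netT _ _ => [|x y lt_xy lt_y].
  by rewrite /= !is_transposition_tperm.
have lt_x : x < m by lia.
have [lt_ym|le_y] := ltnP y m.
  by exists x, y; split=> //; exists [::]; rewrite // big_nil !perm1.
have {lt_xy lt_y le_y} -> : y = a by apply: val_inj => /=; lia.
have ax := lt_neq x lt_x.
have [->|xu] := eqVneq x u.
  exists v, u; split=> //; exists [:: tperm a u; tperm u v]; first exact: subseq_refl.
  rewrite !big_cons big_nil mulg1 !permM tpermR (tpermD av uv) tpermR.
  by rewrite tpermD // eq_sym.
exists x, u; split=> //; exists [:: tperm a u]; first by rewrite /= eqxx.
by rewrite big_seq1 tpermR tpermD // eq_sym.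
Qed.

(** Normally [u] feeds [a] and [v] feeds [b]. When the feeder is itself the other target, the other
    feeder is used and its counter crosses between [a] and [b] by the last switch. *)
Lemma pair_network_add2 p q u v a b m T :
  u < m -> v < m -> u != v -> a = m :> nat -> b = m.+1 :> nat ->
  pair_network p q m T ->
  pair_network p q m.+2 (T ++ [:: tperm b v; tperm a u; tperm a b]).
Proof.
move=> lt_u lt_v uv am bm netT.
have lt_neq x : x < m -> a != x /\ b != x by rewrite -!val_eqE /= am bm; split; lia.
have [[au bu] [av bv]] := (lt_neq u lt_u, lt_neq v lt_v).
have ab : a != b by rewrite -val_eqE /= am bm; lia.
apply: pair_network_cat netT _ _ => [|x y lt_xy lt_y].
  by rewrite /= !is_transposition_tperm.
(* The booleans tell which of the three switches are performed. *)
have reachE (B C D : bool) x' y' :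
    (if D then tperm a b else 1)%g ((if C then tperm a u else 1)%g
       ((if B then tperm b v else 1)%g x')) = x ->
    (if D then tperm a b else 1)%g ((if C then tperm a u else 1)%g
       ((if B then tperm b v else 1)%g y')) = y ->
    pair_reachable x' y' [:: tperm b v; tperm a u; tperm a b] x y.
  move=> <- <-; exists (mask [:: B; C; D] [:: tperm b v; tperm a u; tperm a b]).
    exact: mask_subseq.
  by case: B C D => [] [] [] /=; rewrite ?big_cons big_nil ?mulg1 ?permM ?perm1.
have [lt_ym|le_ym] := ltnP y m.
  by exists x, y; split=> //; [lia | apply: (reachE false false false); rewrite !perm1].
have [lt_ym1|le_ym1] := ltnP y m.+1.
  have {le_ym lt_ym1} ya : y = a by apply: val_inj => /=; lia.
  have lt_x : x < m by rewrite ya am in lt_xy.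
  have [ax bx] := lt_neq x lt_x.
  have [xu|xu] := eqVneq x u.
    exists u, v; split=> //; apply: (reachE true false true); rewrite !perm1 ?xu ?ya.
      by rewrite !tpermD // eq_sym.
    by rewrite !tpermR.
  exists x, u; split=> //; apply: (reachE false true false); rewrite !perm1 ?ya ?tpermR //.
  by rewrite tpermD // eq_sym.
have {le_ym le_ym1} yb : y = b by apply: val_inj => /=; lia.
have [xa|x_neq_a] := eqVneq x a.
  exists u, v; split=> //; apply: (reachE true true false); rewrite !perm1 ?xa ?yb.
    by rewrite (tpermD bu) 1?eq_sym // tpermR.
  by rewrite tpermR tpermD // eq_sym.
have lt_x : x < m by rewrite -val_eqE /= am in x_neq_a; lia.
have [ax bx] := lt_neq x lt_x.
have [xv|xv] := eqVneq x v.
  exists v, u; split=> //; apply: (reachE false true true); rewrite !perm1 ?xv ?yb.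
    by rewrite !tpermD.
  by rewrite tpermR tpermL.
exists x, v; split=> //; apply: (reachE true false false); rewrite !perm1 ?yb ?tpermR //.
by rewrite tpermD // eq_sym.
Qed.

End Pairs.

Lemma exists_pair_network n (p q : 'I_n) m :
  p = 0 :> nat -> q = 1 :> nat -> 2 <= m <= n ->
  exists2 T, pair_network p q m T & size T = uphalf (3 * m) - 2.
Proof.
move=> p0 q1; have pq : p != q by rewrite -val_eqE /= p0 q1.
(* The induction goes by steps of two, since three switches raise [uphalf (3 * m)] exactly as two
   positions do; [m] equal to 2 and 3 are the base cases. *)
elim/ltn_ind: m => -[|[|[|[|m]]]] // IH /andP[_ le_m].
- by exists [:: tperm p q]; first exact: pair_network_tperm.
- exists ([:: tperm p q] ++ [:: tperm (Ordinal le_m) p; tperm p q]) => //.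
  by apply: pair_network_add1; rewrite ?p0 ?q1 //; apply: pair_network_tperm.
have [//||T netT szT] := IH m.+2; first by lia.
have lt_m : m.+2 < n by lia.
exists (T ++ [:: tperm (Ordinal le_m) q; tperm (Ordinal lt_m) p;
                 tperm (Ordinal lt_m) (Ordinal le_m)]).
  by apply: pair_network_add2; rewrite ?p0 ?q1.
by rewrite size_cat szT /=; lia.
Qed.

(* uphalf m is the ceiling of m / 2; 2 <= uphalf (3 * n) since n >= 2. *)
Theorem theorem2 (n : nat) (hn : 2 <= n) :
  (exists T : seq 'S_n,
      reachability_network hn T /\ size T = uphalf (3 * n) - 2) /\
  (forall T : seq 'S_n,
      reachability_network hn T -> uphalf (3 * n) - 2 <= size T).
Proof.
split=> [|T /reachability_network2P[trT reachT]]; last first.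
  have := size_pair_network _ trT reachT; rewrite -val_eqE => /(_ isT).
  (* The length is an integer, so [3 * n <= 2 * size T + 4] rounds up to the claim. *)
  by lia.
have [//|//||T [trT reachT] szT] :=
  @exists_pair_network n (widen_ord hn ord0) (widen_ord hn ord_max) n.
  by rewrite hn leqnn.
exists T; split=> //; apply/reachability_network2P; split=> // x y.
rewrite -val_eqE => xy; have [lt_xy|lt_yx|/= xyE] := ltngtP x y.
- by have [] := reachT x y lt_xy (ltn_ord y).
- by have [] := reachT y x lt_yx (ltn_ord x).
by rewrite /= xyE eqxx in xy.
Qed.
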